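(* Let $(X,d_X)$ and $(Y,d_Y)$ be metric spaces and $f:X\to Y$ a nonconstant continuous function. Suppose that for all $p\in X$ and $r>0$ the open ball $B(p,r)$ is path-connected. Then the following three conditions are equivalent: 1. $f$ is not uniformly continuous on $X$. 2. There exists $\epsilon_0>0$, such that $\delta(x,\epsilon_0)$ is well defined for every $x\in X$ (i.e. $f^{-1}(S[f(x),\epsilon_0])\neq\emptyset$ for every $x\in X$), with $\displaystyle\inf_{x\in X}\delta(x,\epsilon_0)=0$. 3. There exist $\epsilon_0>0$ and sequences $(x_n)$, $(y_n)$ in $X$ such that $\lim_{n\to\infty}d_X(x_n,y_n)=0$ and $d_Y(f(x_n),f(y_n))=\epsilon_0$ for all $n$.
   Context: For $x\in X$ and $\epsilon>0$ with $f^{-1}(S[f(x),\epsilon])\neq\emptyset$, $\delta(x,\epsilon)=\mathrm{dist}(x,f^{-1}(S[f(x),\epsilon]))=\inf\{d_X(x,z): z\in X,\ d_Y(f(z),f(x))=\epsilon\}$, where $S[y_0,\epsilon]=\{y\in Y: d_Y(y_0,y)=\epsilon\}$. $B(p,r)=\{z\in X: d_X(z,p)<r\}$. *)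

(* Defs.v *)
From HB Require Import structures.
From mathcomp Require Import all_boot all_order all_algebra.
From mathcomp Require Import all_classical all_reals all_analysis.
Set Implicit Arguments.
Unset Strict Implicit.
Unset Printing Implicit Defensive.
Import Order.TTheory GRing.Theory Num.Theory.
Import numFieldNormedType.Exports.
Local Open Scope classical_set_scope.
Local Open Scope ring_scope.

Definition path_connected (R : realType) (T : topologicalType) (A : set T) :=
  forall x y : T, A x -> A y ->
  exists g : R -> T, [/\ {within `[0, 1], continuous g},
    g 0 = x, g 1 = y & g @` `[0, 1] `<=` A].

Section metric_defs.
Context {R : realType} {X Y : metricType R}.

Definition sphere (y0 : Y) (e : R) : set Y := [set y | mdist y0 y = e].

(* Since inf set0 = 0, this is the distance to A only for nonempty A. *)
Definition dist_set (x : X) (A : set X) : R := inf [set mdist x z | z in A].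

(* As with dist_set, meaningful only if f @^-1` sphere (f x) e is nonempty. *)
Definition delta (f : X -> Y) (x : X) (e : R) : R :=
  dist_set x (f @^-1` sphere (f x) e).

End metric_defs.

(* Main.v *)
Require Import Defs.
From HB Require Import structures.
From mathcomp Require Import all_boot all_order all_algebra.
From mathcomp Require Import all_classical all_reals all_analysis.
Set Implicit Arguments.
Unset Strict Implicit.
Unset Printing Implicit Defensive.
Import Order.TTheory GRing.Theory Num.Theory.
Import numFieldNormedType.Exports.
Local Open Scope classical_set_scope.
Local Open Scope ring_scope.

(** The substance is that non-uniform continuity yields one [e0] serving every
    point.  Let [e > 0] be such that arbitrarily close pairs [u], [v] satisfy
    [mdist (f u) (f v) >= e], and take [e0 = e / 2].  Fix a point [x] and one
    such pair: by the triangle inequality [f u] or [f v] lies at distance at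
    least [e / 2] from [f x].  Any two points of the space lie in a common ball,
    hence are joined by a path, and the intermediate value theorem applied to
    the distance to [f x] along the image of that path gives a point mapped to
    distance exactly [e0] from [f x] ([mdist_image_IVT]); so the sphere of
    radius [e0] about [f x] is met by [f].  Applying the same lemma inside the
    small ball [ball u d], which contains a close pair [u], [v], bounds
    [delta f u e0] by [d], so the infimum of [delta f ^~ e0] is [0].

    The remaining implications unfold infima: an infimum equal to [0] provides
    points [x_ n] and [y_ n] at distance less than [1 / n.+1] whose images are
    at distance [e0], and such sequences contradict uniform continuity. *)

Section metric_facts.
Context {R : realType}.

Lemma mdist_continuous (T : metricType R) (a : T) :
  continuous (mdist a : T -> R).
Proof.
move=> x; apply/cvgrPdist_lt => e e0.
apply/nbhs_ballP; exists e => //= y; rewrite ballEmdist/= => xye.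
rewrite ltr_distl ltrBlDr; apply/andP; split.
- by rewrite (le_lt_trans (metric_triangle a x y))// ltrD2l.
- by rewrite (le_lt_trans (metric_triangle a y x))// ltrD2l metric_sym.
Qed.

(** On a path-connected set, the distance from [f] to a fixed point [y] of the
    codomain takes every value between any two of its values. *)
Lemma mdist_image_IVT (X Y : metricType R) (f : X -> Y) (A : set X)
    (y : Y) (u v : X) (e : R) :
  continuous f -> path_connected R A -> A u -> A v ->
  mdist y (f u) <= e <= mdist y (f v) ->
  exists2 z, A z & mdist y (f z) = e.
Proof.
move=> cf pcA Au Av uev.
have [g [cg g0 g1 gA]] := pcA _ _ Au Av.
have ch : {within `[0, 1], continuous (mdist y \o f \o g)}.
  apply: within_continuous_comp cg => t _ /=.
  by apply: continuous_comp; [exact: cf|exact: mdist_continuous].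
have [|c c01 <-] := IVT ler01 ch (v := e).
  rewrite /= g0 g1; case/andP: uev => ue ev.
  by rewrite ge_min ue/= le_max ev orbT.
by exists (g c) => //; apply: gA; exists c.
Qed.

(** Any two points lie in a common ball. *)
Lemma path_connectedT (X : metricType R) :
  (forall (p : X) (r : R), 0 < r -> path_connected R (ball p r)) ->
  path_connected R [set: X].
Proof.
move=> pcB x y _ _.
have r0 : 0 < mdist x y + 1 by rewrite ltr_wpDl// mdist_ge0.
have [| |g [cg g0 g1 _]] := pcB x _ r0 x y; first exact: ballxx.
- by rewrite ballEmdist/= ltrDl.
- by exists g.
Qed.

Lemma not_unif_continuousP (X Y : metricType R) (f : X -> Y) :
  ~ unif_continuous f <->
  exists2 e : R, 0 < e & forall d : R, 0 < d ->
    exists u v : X, mdist u v < d /\ e <= mdist (f u) (f v).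
Proof.
split=> [/unif_continuousP nuc|[e e0 he] /unif_continuousP uc].
- move: nuc => /existsNP[e] /not_implyP[e0 ne].
  exists e => // d d0; apply: contrapT => nuv; apply: ne.
  exists d => // -[u v]/=; rewrite !ballEmdist/= => uvd.
  by rewrite ltNge; apply/negP => euv; apply: nuv; exists u, v.
- have [d d0 hd] := uc _ e0; have [u [v [uvd]]] := he _ d0.
  have := hd (u, v); rewrite !ballEmdist/= => /(_ uvd).
  by rewrite ltNge => /negP.
Qed.

End metric_facts.

Section delta_facts.
Context {R : realType} {X Y : metricType R}.
Variable f : X -> Y.

Let dists_lbound (x : X) (A : set X) :
  lbound [set mdist x z | z in A] (0 : R).
Proof. by move=> _ [z _ <-]; exact: mdist_ge0. Qed.

(** This also holds when the sphere is not attained, the infimum of the empty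
    set being [0]. *)
Lemma delta_ge0 (x : X) (e : R) : 0 <= delta f x e.
Proof.
rewrite /delta; have [->|A0] := eqVneq (f @^-1` sphere (f x) e) set0.
  by rewrite /dist_set image_set0 inf0.
apply: lb_le_inf (@dists_lbound _ _); move/set0P: A0 => [z Az].
by exists (mdist x z), z.
Qed.

Lemma delta_le (x z : X) (e : R) :
  mdist (f x) (f z) = e -> delta f x e <= mdist x z.
Proof.
move=> xze; apply: ge_inf; last by exists z.
by exists 0; exact: dists_lbound.
Qed.

Lemma delta_adherent (x : X) (e d : R) :
  f @^-1` sphere (f x) e !=set0 -> delta f x e < d ->
  exists2 z, mdist (f x) (f z) = e & mdist x z < d.
Proof.
move=> [z0 xz0e]; rewrite -subr_gt0 => /inf_adherent.
case/(_ [set mdist x z | z in f @^-1` sphere (f x) e]).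
  by split; [exists (mdist x z0), z0|exists 0; exact: dists_lbound].
by move=> _ [z xze <-]; rewrite addrC subrK; exists z.
Qed.

End delta_facts.

Theorem theorem5 (R : realType) (X Y : metricType R) (f : X -> Y)
  (f_nonconstant : exists x y : X, f x <> f y)
  (f_continuous : continuous f)
  (balls_path_connected :
    forall (p : X) (r : R), 0 < r -> path_connected R (ball p r)) :
  [<->
    (* 1 *)
    ~ unif_continuous f;
    (* 2 *)
    exists e0 : R, [/\ 0 < e0,
      (forall x : X, f @^-1` sphere (f x) e0 !=set0) &
      inf [set delta f x e0 | x in [set: X]] = 0];
    (* 3 *)
    exists (e0 : R) (x_ y_ : nat -> X), [/\ 0 < e0,
      mdist (x_ n) (y_ n) @[n --> \oo] --> (0 : R) &
      forall n : nat, mdist (f (x_ n)) (f (y_ n)) = e0]].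
Proof.
(* The infima range over a nonempty set only because [X] has a point. *)
have [a _] := f_nonconstant.
have delta_lb e : has_lbound [set delta f x e | x in [set: X]].
  by exists 0 => _ [x _ <-]; exact: delta_ge0.
have delta_n0 e : [set delta f x e | x in [set: X]] !=set0.
  by exists (delta f a e), a.
tfae.
- move=> /not_unif_continuousP[e e0 far].
  have e20 : 0 < e / 2 by rewrite divr_gt0.
  exists (e / 2); split => //.
  + move=> x.
    have [w xw] : exists w, e / 2 <= mdist (f x) (f w).
      have [u [v [_ euv]]] := far _ ltr01.
      have [|xu] := leP (e / 2) (mdist (f x) (f u)); first by exists u.
      exists v; rewrite -(lerD2l (mdist (f x) (f u))).
      rewrite (@le_trans _ _ e)//; first by rewrite {2}(splitr e) lerD2r ltW.
      by rewrite (le_trans euv)// (metric_sym (f x) (f u)) metric_triangle.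
    have [|z _ xz] := @mdist_image_IVT _ _ _ f setT (f x) x w (e / 2)
      f_continuous (path_connectedT balls_path_connected) I I.
    * by rewrite mdistxx ltW.
    * by exists z.
  + apply/eqP; rewrite eq_le; apply/andP; split; last first.
      by apply: lb_le_inf => // _ [x _ <-]; exact: delta_ge0.
    apply/ler_addgt0Pl => d d0; rewrite addr0.
    have [u [v [uvd euv]]] := far _ d0.
    have [|||z uz fuz] := @mdist_image_IVT _ _ _ f (ball u d) (f u) u v (e / 2)
      f_continuous (balls_path_connected u d d0).
    * exact: ballxx.
    * by rewrite ballEmdist.
    * rewrite mdistxx (ltW e20)/= (le_trans _ euv)//.
      by rewrite ler_pdivrMr// ler_peMr ?ltW// ltr1n.
    rewrite (@le_trans _ _ (delta f u (e / 2)))//.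
      by apply: ge_inf => //; exists u.
    by rewrite (le_trans (delta_le fuz))// ltW//; move: uz; rewrite ballEmdist.
- move=> [e [e0 sphere_n0 inf_delta]].
  have close n : exists xy : X * X, mdist (f xy.1) (f xy.2) = e /\
      mdist xy.1 xy.2 < harmonic n.
    have hn0 : 0 < harmonic n :> R by rewrite /= invr_gt0.
    have [_ [x _ <-]] := inf_adherent hn0 (conj (delta_n0 e) (delta_lb e)).
    rewrite inf_delta add0r => /(delta_adherent (sphere_n0 x))[z xze xzn].
    by exists (x, z).
  have [xy hxy] := choice close.
  exists e, (fst \o xy), (snd \o xy); split => // [|n]; last by have [] := hxy n.
  apply: (@squeeze_cvgr _ _ _ _ (cst 0) harmonic).
  + by apply: nearW => n; rewrite mdist_ge0 ltW//=; have [] := hxy n.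
  + exact: cvg_cst.
  + exact: cvg_harmonic.
- move=> [e [x_ [y_ [e0 xy0 fxy]]]]; apply/not_unif_continuousP.
  exists e => // d d0.
  have [N _ /(_ N (leqnn N))/= xyN] := cvgr_lt _ xy0 _ d0.
  by exists (x_ N), (y_ N); rewrite fxy.
Qed.
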